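(* Let $A$ and $X$ be standard Borel spaces and let $p \colon A \to X^{\mathbb{N}}$ be a measurable Markov kernel. Then $p$ is exchangeable (that is, for every $a \in A$ the probability measure $p(\,\cdot\,|a)$ on $X^{\mathbb{N}}$ is exchangeable) if and only if there exists a measurable Markov kernel $\mu \colon A \to PX$ such that for every $a\in A$ and every finite collection of measurable subsets $S_1,\dots,S_n \subseteq X$, $$p(S_1\times\cdots\times S_n \,|\, a) \;=\; \int_{PX} q(S_1)\cdots q(S_n)\,\mu(dq\,|\,a).$$
   Context: $X^{\mathbb{N}}$ carries the product $\sigma$-algebra, and for a measure on $X^{\mathbb{N}}$ the expression $p(S_1\times\cdots\times S_n)$ abbreviates the probability of the cylinder $S_1\times\cdots\times S_n\times X\times X\times\cdots$. A measurable Markov kernel $f\colon A\to Z$ assigns to each $a\in A$ a probability measure $f(\,\cdot\,|a)$ on $Z$ such that $a\mapsto f(S|a)$ is measurable for every measurable $S\subseteq Z$. A finite permutation is a bijection $\sigma\colon\mathbb{N}\to\mathbb{N}$ fixing all but finitely many elements; $n_\sigma$ is the largest natural number not fixed by $\sigma$. A probability measure $p$ on $X^{\mathbb{N}}$ is exchangeable if for every finite permutation $\sigma$ and all measurable $S_1,\dots,S_{n_\sigma}\subseteq X$, $p(S_1\times\cdots\times S_{n_\sigma})=p(S_{\sigma(1)}\times\cdots\times S_{\sigma(n_\sigma)})$. $PX$ is the set of probability measures on $X$ equipped with the $\sigma$-algebra generated by the maps $q\mapsto\int f\,dq$ for bounded measurable $f\colon X\to\mathbb{R}$. *)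

(* Defs.v *)
From HB Require Import structures.
From mathcomp Require Import all_boot all_order all_algebra.
From mathcomp Require Import all_classical all_reals all_analysis.

Set Implicit Arguments.
Unset Strict Implicit.
Unset Printing Implicit Defensive.

Import Order.TTheory GRing.Theory Num.Theory.
Import numFieldNormedType.Exports.

Local Open Scope classical_set_scope.
Local Open Scope ring_scope.

#[short(type="completeMetricType")]
HB.structure Definition CompleteMetric (K : numDomainType) :=
  { M of Metric K M & Complete M }.

Definition separable_space (M : topologicalType) : Prop :=
  exists2 D : set M, countable D & dense D.

Definition Borel (M : topologicalType) : set (set M) := <<s @open M >>.

(* [T] is isomorphic, as a measurable space, to the Borel space of a Polish
   space [M]: transporting the topology of [M] along the bijection [f], the
   sigma-algebra of [T] is generated by a Polish topology on [T]. Every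
   [measurableType] is pointed, so the empty space is not covered. *)
Definition standard_borel (R : realType) d (T : measurableType d) : Prop :=
  exists (M : completeMetricType R) (f : T -> M),
    [/\ separable_space M, bijective f &
        @measurable d T = [set f @^-1` B | B in @Borel M]].

Section sequence_space.
Context d (X : measurableType d).

Definition coord_preimages : set (set (nat -> X)) :=
  [set S | exists n : nat, exists2 U : set X,
     measurable U & S = [set x | U (x n)]].

Definition seqspace : measurableType coord_preimages.-sigma :=
  g_sigma_algebraType coord_preimages.

(* [S 0 * ... * S (n - 1) * X * X * ...]; the sets [S i] with [n <= i] are
   irrelevant. *)
Definition cylinder (n : nat) (S : nat -> set X) : set seqspace :=
  [set x | forall i, (i < n)%N -> S i (x i)].

End sequence_space.

Definition finite_perm (s : nat -> nat) : Prop :=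
  bijective s /\ finite_set [set i | s i <> i].

Definition last_moved (s : nat -> nat) (m : nat) : Prop :=
  s m <> m /\ forall i, (m < i)%N -> s i = i.

(* Coordinates are numbered from 0, so the coordinates up to the last moved
   one, [m], are the first [m.+1] ones. The identity has no last moved point
   and imposes no condition. *)
Definition exchangeable (R : realType) d (X : measurableType d)
    (P : {measure set (seqspace X) -> \bar R}) : Prop :=
  forall (s : nat -> nat) (m : nat), finite_perm s -> last_moved s m ->
  forall S : nat -> set X, (forall i, (i < m.+1)%N -> measurable (S i)) ->
    P (cylinder m.+1 S) = P (cylinder m.+1 (fun i => S (s i))).

Section probability_space.
Context d (X : measurableType d) (R : realType).

(* The generators of the smallest sigma-algebra making the maps
   [q |-> \int[q]_x f x] measurable, for [f] bounded and measurable. The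
   library's [pprobability] is instead generated by the evaluations
   [q |-> q U]. *)
Definition integral_preimages : set (set (probability X R)) :=
  [set V | exists f : X -> R,
     [/\ measurable_fun setT f, (exists c : R, forall x, `|f x| <= c) &
         exists2 B : set R, measurable B &
           V = [set q : probability X R | B (\int[q]_x f x)]]].

Definition probspace : measurableType integral_preimages.-sigma :=
  g_sigma_algebraType integral_preimages.

End probability_space.

(* Main.v *)
Require Import Defs.
From HB Require Import structures.
From mathcomp Require Import all_boot all_order all_algebra.
From mathcomp Require Import all_classical all_reals all_analysis.
From mathcomp Require Import measurable_realfun.
From mathcomp Require Import lra ring zify.

Set Implicit Arguments.
Unset Strict Implicit.
Unset Printing Implicit Defensive.

Import Order.TTheory GRing.Theory Num.Theory.
Import numFieldNormedType.Exports.

Local Open Scope classical_set_scope.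
Local Open Scope ring_scope.

(** De Finetti's theorem, uniformly in a parameter. The point of the proof is
    that the directing measure of an exchangeable law can be read off from the
    sample sequence by one measurable map [directing_measure], from sequences
    to probability measures, that does not refer to the law. The kernel [mu]
    is then the image of [p] under this map, so no measurable selection in the
    parameter is needed.

    For an exchangeable [P] the indicators of [S (x i)] have a common pair
    correlation, which bounds the mean-square distance between the averages
    over any two index sets of sizes [n] and [m] by [1/n + 1/m]
    ([avgB_second_moment]). Along the sizes [4 ^ k] the averages therefore
    converge almost surely, and averages over disjoint blocks of indices have
    the same limit ([ae_avg_cvg], [ae_avgB_cvg0]). A product of averages over
    disjoint blocks involves only distinct coordinates, so its expectation is
    exactly the probability of a cylinder; passing to the limit expresses
    cylinder probabilities as moments of the limiting averages
    ([exchangeable_cylinder]).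

    It remains to realize the limiting averages by a genuine measure. On the
    line the upper limits of the averages over half-lines, made
    right-continuous, form a distribution function for every sequence and hence
    define a Lebesgue-Stieltjes measure ([limit_law]); a pi-lambda argument
    shows that the averages converge almost surely to this measure on each
    Borel set ([ae_cvg_limit_law]). A standard Borel space is a measurable retract of the
    line ([standard_borel_retract]): encode its points by real numbers in the
    unit interval, and transport the law back along the decoding map.

    Conversely, a product over coordinates is unchanged when a permutation
    reindexes its factors. *)

(** * Measurable retraction of a Polish space onto the line *)

Section binary_codes.
Context (R : realType).
Implicit Types (b : nat -> bool) (t : R).

Definition ternary_term b (j : nat) : R := (2 * (b j)%:R) / 3 ^+ j.+1.

(** The Cantor-set coding: only the ternary digits 0 and 2 occur, so distinct
    bit sequences are kept apart and the digits can be read off by thresholds. *)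
Definition ternary b : R := limn (series (ternary_term b)).

Let ternary_term_ge0 b j : 0 <= ternary_term b j.
Proof. by rewrite divr_ge0 ?mulr_ge0 ?exprn_ge0. Qed.

Let series_ternary_le b n : series (ternary_term b) n <= 1 - 3 ^- n.
Proof.
rewrite /series /=; elim: n => [|n IHn].
  by rewrite big_geq // expr0 invr1 subrr.
rewrite big_nat_recr //=; apply: (le_trans (lerD IHn (_ : _ <= 2 / 3 ^+ n.+1))).
  rewrite ler_wpM2r ?invr_ge0 ?exprn_ge0 //.
  by rewrite ler_piMr // lern1 leq_b1.
rewrite exprS invfM.
have : (0 : R) <= 3 ^- n by rewrite invr_ge0 exprn_ge0.
lra.
Qed.

Lemma cvg_ternary b : series (ternary_term b) n @[n --> \oo] --> ternary b.
Proof.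
apply: nondecreasing_is_cvgn.
  by move=> m n; apply: (@nondecreasing_series R (ternary_term b) xpredT 0%N) => *.
exists 1 => _ [n _ <-]; apply: le_trans (series_ternary_le b n) _.
by rewrite gerBl invr_ge0 exprn_ge0.
Qed.

Lemma ternary01 b : 0 <= ternary b <= 1.
Proof.
have cb : cvgn (series (ternary_term b)) by apply/cvg_ex; eexists; exact: cvg_ternary.
apply/andP; split.
  by apply: limr_ge => //; apply: nearW => n; exact: sumr_ge0.
apply: limr_le => //; apply: nearW => n.
apply: le_trans (series_ternary_le b n) _.
by rewrite gerBl invr_ge0 exprn_ge0.
Qed.

Lemma ternary_shift b :
  ternary b = (2 * (b 0%N)%:R + ternary (fun j => b j.+1)) / 3.
Proof.
have := @cvg_ternary b; rewrite -cvg_shiftS /= => h1.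
have h2 : (2 * (b 0%N)%:R + series (ternary_term (fun j => b j.+1)) n) / 3
    @[n --> \oo] --> (2 * (b 0%N)%:R + ternary (fun j => b j.+1)) / 3.
  apply: cvgM; last exact: cvg_cst.
  by apply: cvgD; [exact: cvg_cst|exact: cvg_ternary].
rewrite -(cvg_lim _ h1) // -(cvg_lim _ h2) //; congr (limn _).
apply/funext => n; rewrite /series /= big_nat_recl //= mulrDl mulr_suml.
congr (_ + _).
by apply: eq_bigr => i _; rewrite /ternary_term [3 ^+ _.+2]exprSr invfM mulrA.
Qed.

(** On the Cantor set [2^-1 <= t] tests whether the first digit is 2, and this
    map drops that digit. *)
Definition ternary_rest t : R := 3 * t - 2 * (2^-1 <= t)%R%:R.

Definition digit (j : nat) t : bool := 2^-1 <= iter j ternary_rest t.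

Let half_le_ternary b : (2^-1 <= ternary b) = b 0%N.
Proof.
rewrite ternary_shift; have := ternary01 (fun j => b j.+1).
by case: (b 0%N) => /= /andP[h0 h1]; [|apply/negbTE; rewrite -ltNge]; lra.
Qed.

Lemma digit_ternary b j : digit j (ternary b) = b j.
Proof.
rewrite /digit; elim: j b => [|j IHj] b; first exact: half_le_ternary.
rewrite iterSr (_ : ternary_rest _ = ternary (fun j => b j.+1)); first exact: IHj.
rewrite /ternary_rest half_le_ternary ternary_shift.
by field.
Qed.

Lemma measurable_digit j : measurable [set t | digit j t].
Proof.
have mi : measurable_fun setT (iter j ternary_rest).
  elim: j => [|j IHj]; first exact: measurable_id.
  rewrite (_ : iter j.+1 _ = ternary_rest \o iter j ternary_rest) //.
  apply: measurableT_comp => //.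
  rewrite (_ : ternary_rest =
      (fun t => 3 * t - 2 * \1_(`[2^-1, +oo[%classic : set R) t)).
    apply: measurable_funB; first exact: measurable_funM.
    by apply: measurable_funM => //; exact: measurable_indic.
  apply/funext => t; rewrite /ternary_rest indicE.
  congr (_ - _ * (nat_of_bool _)%:R).
  by apply/idP/idP => [h|/set_mem]; [apply/mem_set|]; rewrite /= in_itv /= andbT.
rewrite (_ : [set t | _] = iter j ternary_rest @^-1` `[2^-1, +oo[%classic).
  by rewrite -[X in measurable X]setTI; apply: mi.
by apply/seteqP; split => t; rewrite /digit /= in_itv /= andbT.
Qed.

Lemma measurable_ternary d (X : measurableType d) (b : nat -> X -> bool) :
  (forall j, measurable [set y | b j y]) ->
  measurable_fun setT (fun y => ternary (b ^~ y)).
Proof.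
move=> mb.
apply: (@measurable_fun_cvg _ _ _ _ (fun n y => series (ternary_term (b ^~ y)) n)).
  move=> n; rewrite /series /=; apply: measurable_sum => j.
  rewrite /ternary_term; apply: measurable_funM => //; apply: measurable_funM => //.
  rewrite (_ : (fun y => _) = \1_[set y | b j y]); first exact: measurable_indic.
  by apply/funext => y; rewrite indicE; congr (nat_of_bool _)%:R; apply/idP/idP => [?|/set_mem]; first exact/mem_set.
by move=> y _; exact: cvg_ternary.
Qed.

End binary_codes.

(** Among countably many measurable conditions the index of the first one that
    holds is a measurable choice. *)
Lemma measurable_choice d (T : measurableType d) (D : nat -> set T) :
  (forall n, measurable (D n)) ->
  exists m : T -> nat,
    (forall t, (exists n, D n t) -> D (m t) t) /\
    (forall V : set nat, measurable (m @^-1` V)).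
Proof.
move=> mD; pose E := seqDU D.
have mE n : measurable (E n) by exact: seqDU_measurable.
pose m t := xget 0%N [set n | E n t].
have Em t : (exists n, E n t) -> E (m t) t by exact: xgetPex.
have mE1 t n : E n t -> m t = n.
  move=> Ent; have Emt := Em t (ex_intro _ n Ent).
  by apply: (trivIset_seqDU D) => //; exists t.
have m1 n : (0 < n)%N -> m @^-1` [set n] = E n.
  move=> n0; apply/seteqP; split => [t /= mtn|t /mE1 //].
  move: mtn; rewrite /m; case: xgetP => [k -> Ek <- //|_ n00].
  by rewrite -n00 in n0.
have mm1 n : measurable (m @^-1` [set n]).
  case: n => [|n]; last by rewrite m1.
  rewrite (_ : _ @^-1` _ = ~` \bigcup_n E n.+1).
    by apply: measurableC; exact: bigcupT_measurable.
  apply/seteqP; split => [t /= mt0 [n _ /mE1]|t /=]; first by rewrite mt0.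
  move=> Et; case mt : (m t) => [|n] //; exfalso; apply: Et; exists n => //.
  by rewrite -m1.
exists m; split => [t [n Dnt]|V].
  suff : E (m t) t by case.
  apply: Em; have : (\bigcup_k D k) t by exists n.
  by rewrite seqDU_bigcup_eq => -[k _ Ekt]; exists k.
rewrite (_ : m @^-1` V = \bigcup_(n in V) m @^-1` [set n]).
  exact: bigcup_measurable.
by apply/seteqP; split => [t Vt|t [n Vn /= ->]] //; exists (m t).
Qed.

Lemma expr2_small (R : realType) (C e : R) : 0 < e -> exists k, C / 2 ^+ k < e.
Proof.
move=> e0; exists (Num.truncn (C / e)).+1; rewrite ltr_pdivrMr ?exprn_gt0 //.
rewrite mulrC -ltr_pdivrMr //; apply: (lt_trans (truncnS_gt _)).
by rewrite -natrX ltr_nat ltn_expl.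
Qed.

Section polish_retract.
Context (R : realType) (M : completeMetricType R).
Let dist := @mdist R M.

Let tri y x z : dist x z <= dist x y + dist y z.
Proof. exact: metric_triangle. Qed.

Let sym x y : dist x y = dist y x.
Proof. exact: metric_sym. Qed.

Lemma open_mball (x : M) (e : R) : open [set y | dist x y < e].
Proof.
rewrite openE => y /= xy; apply/nbhs_ballP.
exists (e - dist x y); first by rewrite /= subr_gt0.
move=> z; rewrite ballEmdist /= ltrBrDl => yz.
exact: le_lt_trans (tri _ _ _) yz.
Qed.

Lemma separable_dense_seq : separable_space M ->
  exists q : nat -> M, forall x e, 0 < e -> exists n, dist x (q n) < e.
Proof.
move=> [D /countable_injP[h hI] dD].
exists (fun n => xget point [set y | D y /\ h y = n]) => x e e0.
have [|y [/= xy Dy]] := dD [set y | dist x y < e] _ (open_mball x e).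
  by exists x; rewrite /= /dist mdistxx.
exists (h y); set z := xget _ _.
have [Dz hz] : [set y' | D y' /\ h y' = h y] z by apply: xgetPex; exists y.
by rewrite (hI z y) ?inE.
Qed.

(** The error bound is the tail of the geometric series of the steps. *)
Lemma fast_cauchy_limit (y : nat -> M) :
  (forall k, dist (y k) (y k.+1) <= 2 / 2 ^+ k) ->
  exists l, forall k, dist (y k) l <= 4 / 2 ^+ k.
Proof.
move=> hy.
have yy k i : dist (y k) (y (k + i)%N) <= 4 / 2 ^+ k - 4 / 2 ^+ (k + i).
  elim: i => [|i IHi]; first by rewrite addn0 subrr /dist mdistxx.
  apply: le_trans (tri (y (k + i)%N) _ _) _.
  rewrite addnS; apply: le_trans (lerD IHi (hy _)) _.
  rewrite exprS invfM; lra.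
have yk k i : dist (y k) (y (k + i)%N) <= 4 / 2 ^+ k.
  by apply: le_trans (yy k i) _; rewrite gerBl divr_ge0 ?exprn_ge0.
have : cauchy (y @ \oo).
  apply: cauchy_exP => e e0; have [k ke] := expr2_small 4 e0.
  exists (y k); exists k => // i /= ki; rewrite ballEmdist /=.
  by rewrite -(subnKC ki); exact: le_lt_trans (yk _ _) ke.
move=> /cauchy_cvg /cvg_ex[l yl]; exists l => k.
apply/ler_addgt0Pr => e e0.
have /cvg_ballP/(_ e e0)[N _ hN] := yl.
have := hN (k + N)%N (leq_addl _ _); rewrite ballEmdist /= => lN.
apply: le_trans (tri (y (k + N)%N) _ _) _.
by rewrite lerD // ltW // sym.
Qed.

(** The bits of [x] record which balls of radius [2 ^- k] around the points of a
    dense sequence contain [x]. To decode a real, take at each scale [k] the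
    first centre whose bit is set and pass to the limit of these centres. For
    reals that are not codes the centres may fail to converge; the default value
    is used unless consecutive centres satisfy the bound that holds for codes.
    The decoding is measurable since it is a limit, with a uniform rate, of
    functions with countably many values. *)
Lemma polish_retract : separable_space M ->
  exists (b : nat -> M -> bool) (g : R -> M),
    [/\ forall j, open [set x | b j x],
        forall x, g (ternary R (b ^~ x)) = x &
        forall V, open V -> measurable (g @^-1` V)].
Proof.
move=> /separable_dense_seq[q hq].
pose b j x := oapp (fun kn : nat * nat => dist (q kn.2) x < 2 ^- kn.1) false (unpickle j).
pose D (k n : nat) := [set t : R | digit (pickle (k, n)) t].
have mD k n : measurable (D k n) by exact: measurable_digit.
have /choice[m hm] : forall k, exists m : R -> nat,
    (forall t, (exists n, D k n t) -> D k (m t) t) /\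
    (forall V : set nat, measurable (m @^-1` V)).
  by move=> k; exact: measurable_choice.
pose y t k := q (m k t).
pose F := [set t | forall k, dist (y t k) (y t k.+1) <= 2 / 2 ^+ k].
pose L t := [set l | forall k, dist (y t k) l <= 4 / 2 ^+ k].
pose g t := if pselect (F t) then xget point (L t) else point.
have Fg t : F t -> forall k, dist (y t k) (g t) <= 4 / 2 ^+ k.
  move=> Ft; have -> : g t = xget point (L t) by rewrite /g; case: (pselect _).
  suff : L t (xget point (L t)) by [].
  by apply: xgetPex; exact: fast_cauchy_limit.
have nFg t : ~ F t -> g t = point by rewrite /g; case: (pselect _).
exists b, g; split.
- move=> j; rewrite /b; case: (unpickle j) => [[k n]|] /=.
    exact: open_mball.
  rewrite (_ : [set _ | _] = set0); first exact: open0.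
  by apply/seteqP; split.
- move=> x; set t := ternary R _.
  have yx k : dist (y t k) x < 2 ^- k.
    have DE n : D k n t = (dist (q n) x < 2 ^- k).
      by rewrite /D /= digit_ternary /b pickleK.
    rewrite /y -DE; apply: (hm k).1.
    have [|n xn] := hq x (2 ^- k); first by rewrite invr_gt0 exprn_gt0.
    by exists n; rewrite DE sym.
  have Ft : F t.
    move=> k; apply: le_trans (tri x _ _) _.
    rewrite [X in _ + X]sym.
    apply: le_trans (lerD (ltW (yx k)) (ltW (yx k.+1))) _.
    rewrite exprS invfM; have : (0 : R) <= 2 ^- k by rewrite invr_ge0 exprn_ge0.
    lra.
  apply: mdist_positivity; apply/eqP; rewrite eq_le mdist_ge0 andbT.
  apply/ler_addgt0Pr => e e0; rewrite add0r.
  have [k ke] := expr2_small 5 e0; apply: le_trans (ltW ke).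
  apply: le_trans (tri (y t k) _ _) _.
  rewrite [X in X + _]sym.
  apply: le_trans (lerD (Fg t Ft k) (ltW (yx k))) _; lra.
- move=> V oV.
  have mF : measurable F.
    rewrite (_ : F = \bigcap_k \bigcup_(n in setT) ((m k @^-1` [set n]) `&`
       (m k.+1 @^-1` [set n' | dist (q n) (q n') <= 2 / 2 ^+ k]))).
      apply: bigcapT_measurable => k; apply: bigcupT_measurable => n.
      by apply: measurableI; exact: (hm _).2.
    apply/seteqP; split => [t Ft k _|t Ft k].
    by exists (m k t) => //; split => //; exact: Ft.
    by have [n _ [/= <-]] := Ft k Logic.I.
  have mball k : measurable [set t | [set z | dist (y t k) z < 5 / 2 ^+ k] `<=` V].
    exact: ((hm k).2 [set n | [set z | dist (q n) z < 5 / 2 ^+ k] `<=` V]).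
  (* As the centre at scale k is within 4 / 2 ^+ k of the limit, the limit lies
     in V as soon as the ball of radius 5 / 2 ^+ k does; conversely, if the ball
     of radius 9 / 2 ^+ k = (4 + 5) / 2 ^+ k around the limit lies in V, so does
     that smaller ball around the centre. *)
  have -> : g @^-1` V = (F `&` \bigcup_k [set t | [set z | dist (y t k) z < 5 / 2 ^+ k] `<=` V])
      `|` (~` F `&` [set t | V point]).
    apply/seteqP; split => t.
      move=> Vgt; have [Ft|nFt] := pselect (F t); last first.
        by right; split => //; rewrite -(nFg t nFt).
      left; split => //; move: oV; rewrite openE => /(_ _ Vgt)/nbhs_ballP[e /= e0 eV].
      have [k ke] := expr2_small 9 e0; exists k => // z /= yz.
      apply: eV; rewrite ballEmdist /=; apply: le_lt_trans ke.
      apply: le_trans (tri (y t k) _ _) _.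
      rewrite [X in X + _]sym.
      apply: le_trans (lerD (Fg t Ft k) (ltW yz)) _; lra.
    move=> [[Ft [k _ kV]]|[nFt Vp]]; last by rewrite /preimage /= nFg.
    apply: kV => /=; apply: le_lt_trans (Fg t Ft k) _.
    by rewrite ltr_pM2r ?invr_gt0 ?exprn_gt0 // ltr_nat.
  apply: measurableU.
    by apply: measurableI => //; exact: bigcupT_measurable.
  apply: measurableI; first exact: measurableC.
  have [Vp|nVp] := pselect (V point).
    by rewrite (_ : [set _ | _] = setT) //; apply/seteqP; split.
  by rewrite (_ : [set _ | _] = set0) //; apply/seteqP; split.
Qed.

End polish_retract.

(** Every measurable set is the preimage under [c] of a Borel set, namely of its
    preimage under [g]; this is how the statements on the line are used. *)
Lemma standard_borel_retract (R : realType) d (X : measurableType d) :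
  standard_borel R X ->
  exists (c : X -> R) (g : R -> X),
    [/\ measurable_fun setT c, measurable_fun setT g,
        forall x, 0 <= c x <= 1 & cancel c g].
Proof.
move=> [M [f [sM [f' fK f'K] mX]]].
have [b [h [ob hK mh]]] := polish_retract sM.
have mf B : Borel B -> measurable (f @^-1` B) by move=> sB; rewrite mX; exists B.
exists (fun x => ternary R (b ^~ (f x))), (f' \o h); split.
- apply: measurable_ternary => j.
  by apply: (mf [set x | b j x]); apply: sub_sigma_algebra; exact: ob.
- move=> _ S mS; rewrite setTI.
  have [B sB BS] : [set f @^-1` B | B in @Borel M] S by rewrite -mX.
  rewrite -BS (_ : _ @^-1` _ = h @^-1` B); last first.
    by apply/seteqP; split => t /=; rewrite /preimage /= f'K.
  suff : @Borel M `<=` [set B | measurable (h @^-1` B)] by apply.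
  apply: smallest_sub => //; split => /=.
  + by rewrite preimage_set0.
  + by move=> A mA; rewrite setTD preimage_setC; exact: measurableC.
  + by move=> A mA; rewrite preimage_bigcup; exact: bigcupT_measurable.
- by move=> x; exact: ternary01.
- by move=> x; rewrite /= hK.
Qed.

(** * Invariance under injections of the coordinates *)

Section exchangeable_permutations.
Context (R : realType) d (X : measurableType d).
Variable P : {measure set (seqspace X) -> \bar R}.

Lemma measurable_coord (n : nat) : measurable_fun [set: seqspace X] (fun x : seqspace X => x n).
Proof.
move=> _ U mU; rewrite setTI; apply: sub_sigma_algebra.
by exists n, U.
Qed.

Lemma measurable_cylinder n (S : nat -> set X) :
  (forall i, (i < n)%N -> measurable (S i)) -> measurable (cylinder n S).
Proof.
move=> mS.
rewrite (_ : cylinder n S =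
  \bigcap_(i in [set i | (i < n)%N]) ((fun x : seqspace X => x i) @^-1` S i)) //.
apply: bigcap_measurableType => i /= /mS mSi.
by rewrite -[X in measurable X]setTI; exact: measurable_coord.
Qed.

Hypothesis exP : exchangeable P.

(** Exchangeability constrains only the cylinders whose length is determined by
    the last moved coordinate. If [s] fixes the last coordinate of a longer
    cylinder, compose it with a transposition moving that coordinate: then [s] is
    the product of two permutations to which the hypothesis applies. *)
Lemma exchangeable_perm (N : nat) (s : nat -> nat) (S : nat -> set X) :
  bijective s -> (forall i, (N <= i)%N -> s i = i) ->
  (forall i, measurable (S i)) ->
  P (cylinder N S) = P (cylinder N (fun i => S (s i))).
Proof.
have moved t M T : bijective t -> (forall i, (M < i)%N -> t i = i) ->
    t M <> M -> (forall i, measurable (T i)) ->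
    P (cylinder M.+1 T) = P (cylinder M.+1 (fun i => T (t i))).
  move=> bt tfix tM mT; apply: exP => //; split => //.
  apply: (sub_finite_set _ (finite_II M.+1)) => i /= ti.
  by rewrite ltnS leqNgt; apply/negP => /tfix.
move=> bs sfix mS; case: N sfix => [|M] sfix.
  by congr (P _); apply/seteqP; split => x /= h i.
have [sM|sM] := pselect (s M = M); last exact: moved.
have [M0|M0] := posnP M.
  move: sM; rewrite M0 => s0.
  congr (P _); apply: eq_set => x; apply: eq_forall => i.
  by apply/propext; case: i => [|i]; rewrite ?s0.
(* The transposition of M and 0. *)
pose t i := if i == M then 0%N else if i == 0%N then M else i.
have tt : involutive t.
  by move=> i; rewrite /t; do 4?[case: eqP => //=] => *; lia.
have bt : bijective t by exists t.
have tfix i : (M < i)%N -> t i = i.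
  by rewrite /t; do 2?[case: eqP => //=] => *; lia.
have sinj := bij_inj bs.
rewrite (moved (s \o t) M S) //=.
- rewrite (moved t M (fun i => S (s (t i)))) //=.
  + by congr (P _); apply: eq_set => x; apply: eq_forall => i; rewrite tt.
  + by rewrite /t eqxx; lia.
- exact: bij_comp.
- by move=> i Mi; rewrite tfix // sfix.
- by rewrite /t eqxx -[X in _ <> X]sM => /sinj; lia.
Qed.

(** An injection of finitely many indices extends to a finite permutation: list
    its values first, then the remaining indices below a common bound. *)
Lemma exchangeable_inj (n : nat) (phi : nat -> nat) (S : nat -> set X) :
  {in [pred i | (i < n)%N] &, injective phi} ->
  (forall i, (i < n)%N -> measurable (S i)) ->
  P [set x : seqspace X | forall j, (j < n)%N -> S j (x (phi j))] = P (cylinder n S).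
Proof.
move=> phiI mS.
pose F := [seq phi i | i <- iota 0 n].
have uF : uniq F.
  rewrite map_inj_in_uniq ?iota_uniq // => i j; rewrite !mem_iota /= => ? ?.
  exact: phiI.
have sF : size F = n by rewrite size_map size_iota.
have nF i : (i < n)%N -> nth 0%N F i = phi i.
  by move=> ni; rewrite (nth_map 0%N) ?size_iota // nth_iota.
pose N := (n + \max_(i < n) (phi i).+1)%N.
have FN j : j \in F -> (j < N)%N.
  move=> /mapP[i]; rewrite mem_iota /= add0n => ni ->.
  apply: leq_trans (leq_addl _ _).
  exact: (leq_bigmax (F := fun i : 'I_n => (phi i).+1) (Ordinal ni)).
pose L := F ++ [seq i <- iota 0 N | i \notin F].
have uL : uniq L.
  rewrite cat_uniq uF filter_uniq ?iota_uniq // andbT.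
  by apply/hasPn => i; rewrite mem_filter => /andP[].
have mL i : (i \in L) = (i < N)%N.
  rewrite mem_cat mem_filter mem_iota /= add0n.
  by have [/FN ->|//] := boolP (i \in F).
have sL : size L = N.
  rewrite -[RHS](size_iota 0); apply: perm_size; apply: uniq_perm => //.
    exact: iota_uniq.
  by move=> i; rewrite mL mem_iota.
have nN : (n <= N)%N by exact: leq_addr.
pose s i := if (i < N)%N then nth 0%N L i else i.
have bs : bijective s.
  exists (fun j => if (j < N)%N then index j L else j) => i; rewrite /s.
    have [iN|iN] := ltnP i N; last by rewrite ltnNge iN.
    by rewrite -mL mem_nth ?sL // index_uniq ?sL.
  have [iN|iN] := ltnP i N; last by rewrite ltnNge iN.
  by rewrite -[X in (_ < X)%N]sL index_mem mL iN nth_index ?mL.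
pose T m := if m \in F then S (index m F) else setT.
have mT i : measurable (T i).
  rewrite /T; case: ifPn => // iF; apply: mS.
  by rewrite -sF index_mem.
have TF i : (i < n)%N -> T (phi i) = S i.
  move=> ni; rewrite /T -nF // mem_nth ?sF // index_uniq ?sF //.
transitivity (P (cylinder N T)).
  congr (P _); apply/seteqP; split => x /= h j.
    rewrite /T; case: ifPn => // jF jN.
    have jn : (index j F < n)%N by rewrite -sF index_mem.
    by have := h _ jn; rewrite -nF // nth_index.
  move=> jn; rewrite -TF //; apply: h; apply: FN.
  by rewrite -nF // mem_nth // sF.
rewrite (exchangeable_perm bs) //; last first.
  by move=> i Ni; rewrite /s ltnNge Ni.
congr (P _); apply/seteqP; split => x /= h j jn.
  have := h j (leq_trans jn nN).
  by rewrite /s (leq_trans jn nN) nth_cat sF jn nF // TF.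
rewrite /s jn; have [jn'|jn'] := ltnP j n.
  by rewrite nth_cat sF jn' nF // TF //; apply: h.
rewrite /T ifN // nth_cat sF ltnNge jn' /=.
set k := nth _ _ _.
have : k \in [seq i <- iota 0 N | i \notin F].
  by rewrite mem_nth // ltn_subLR //; move: sL; rewrite size_cat sF => ->.
by rewrite mem_filter => /andP[].
Qed.

End exchangeable_permutations.

(** * Mean-square convergence of empirical averages *)

Section bounded_functions.
Context d (T : measurableType d) (R : realType).
Variable P : probability T R.

Definition bounded_measurable (f : T -> R) : Prop :=
  measurable_fun setT f /\ exists M, forall x, `|f x| <= M.

Lemma bounded_measurable_integrable f :
  bounded_measurable f -> P.-integrable setT (EFin \o f).
Proof.
move=> [mf [M hM]]; apply: measurable_bounded_integrable => //.
  exact: le_lt_trans (probability_le1 P measurableT) (ltry _).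
exists M; split; first exact: num_real.
by move=> y My x _; exact: le_trans (hM x) (ltW My).
Qed.

Lemma bounded_measurable_cst (r : R) : bounded_measurable (fun=> r).
Proof. by split; [exact: measurable_cst | exists `|r|]. Qed.

Lemma bounded_measurableD f g : bounded_measurable f -> bounded_measurable g ->
  bounded_measurable (fun x => f x + g x).
Proof.
move=> [mf [M hM]] [mg [N hN]]; split; first exact: measurable_funD.
by exists (M + N) => x; rewrite (le_trans (ler_normD _ _)) // lerD.
Qed.

Lemma bounded_measurableM f g : bounded_measurable f -> bounded_measurable g ->
  bounded_measurable (fun x => f x * g x).
Proof.
move=> [mf [M hM]] [mg [N hN]]; split; first exact: measurable_funM.
by exists (M * N) => x; rewrite normrM ler_pM.
Qed.

Lemma bounded_measurable_norm f : bounded_measurable f ->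
  bounded_measurable (fun x => `|f x|).
Proof.
move=> [mf [M hM]]; split; first exact: measurableT_comp.
by exists M => x; rewrite normr_id.
Qed.

Lemma bounded_measurableB f g : bounded_measurable f -> bounded_measurable g ->
  bounded_measurable (fun x => f x - g x).
Proof.
move=> [mf [M hM]] [mg [N hN]]; split; first exact: measurable_funB.
by exists (M + N) => x; rewrite (le_trans (ler_normB _ _)) // lerD.
Qed.

Lemma bounded_measurable_sum I (s : seq I) (f : I -> T -> R) :
  (forall i, bounded_measurable (f i)) ->
  bounded_measurable (fun x => \sum_(i <- s) f i x).
Proof.
move=> bf; elim: s => [|i s IHs].
  by under eq_fun do rewrite big_nil; exact: bounded_measurable_cst.
by under eq_fun do rewrite big_cons; exact: bounded_measurableD.
Qed.

Lemma bounded_measurable_prod I (s : seq I) (f : I -> T -> R) :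
  (forall i, bounded_measurable (f i)) ->
  bounded_measurable (fun x => \prod_(i <- s) f i x).
Proof.
move=> bf; elim: s => [|i s IHs].
  by under eq_fun do rewrite big_nil; exact: bounded_measurable_cst.
by under eq_fun do rewrite big_cons; exact: bounded_measurableM.
Qed.

Lemma Rintegral_probability_cst (r : R) : \int[P]_x r = r.
Proof. by rewrite Rintegral_cst //= probability_setT /= mulr1. Qed.

Lemma Rintegral_sum I (s : seq I) (f : I -> T -> R) :
  (forall i, bounded_measurable (f i)) ->
  \int[P]_x (\sum_(i <- s) f i x) = \sum_(i <- s) \int[P]_x f i x.
Proof.
move=> bf; elim: s => [|i s IHs].
  under eq_Rintegral do rewrite big_nil.
  by rewrite Rintegral_cst // mul0r big_nil.
under eq_Rintegral do rewrite big_cons.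
rewrite RintegralD ?IHs ?big_cons //; apply: bounded_measurable_integrable => //.
exact: bounded_measurable_sum.
Qed.

(** Summable first moments force almost sure absolute convergence, because the
    sum of the integrals is the integral of the sum. *)
Lemma ae_cvg_series (u : nat -> T -> R) (C : R) :
  (forall k, bounded_measurable (u k)) ->
  (forall k, \int[P]_x `|u k x| <= C / 2 ^+ k) ->
  {ae P, forall x, cvgn (series (fun k => u k x))}.
Proof.
move=> bu hu.
have mu k : measurable_fun setT (fun x => `|u k x|%:E).
  apply/measurable_EFinP; exact: (bounded_measurable_norm (bu k)).1.
have fin : (\int[P]_x \sum_(k <oo) `|u k x|%:E < +oo)%E.
  rewrite integral_nneseries //.
  apply: (@le_lt_trans _ _ (\sum_(k <oo) (geometric C (2^-1) k)%:E)%E).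
    apply: lee_nneseries => k *.
      by apply: integral_ge0 => x _; rewrite lee_fin.
    rewrite -[leLHS]fineK; last first.
      apply: integrable_fin_num => //.
      exact: bounded_measurable_integrable (bounded_measurable_norm (bu k)).
    by rewrite lee_fin /geometric /= exprVn; exact: hu.
  have cg := @is_cvg_geometric_series R C (2^-1).
  have {}cg := cg (ltac:(by rewrite ger0_norm // invf_lt1 // ltr1n)).
  rewrite (_ : (\sum_(k <oo) _)%E = (limn (series (geometric C 2^-1)))%:E) ?ltry //.
  rewrite -EFin_lim //; congr (limn _).
  by apply/funext => n; rewrite /= /series /= sumEFin.
have int : P.-integrable setT (fun x => \sum_(k <oo) `|u k x|%:E)%E.
  apply/integrableP; split.
    by apply: ge0_emeasurable_sum => // k x _ _; rewrite lee_fin.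
  under eq_integral do rewrite gee0_abs ?nneseries_ge0 //.
  exact: fin.
apply: filterS (integrable_ae measurableT int) => x /(_ Logic.I) fx.
apply: normed_cvg.
have ndx : nondecreasing_seq [normed series (fun k => u k x)].
  by move=> m n; apply: (@nondecreasing_series R (fun n => `|u n x|) xpredT 0%N) => *.
apply: nondecreasing_is_cvgn => //.
exists (fine (\sum_(k <oo) `|u k x|%:E)%E) => _ [n _ <-].
rewrite -lee_fin fineK // /series /= -sumEFin.
by apply: nneseries_lim_ge => *; rewrite lee_fin.
Qed.

End bounded_functions.

Section empirical_averages.
Context (R : realType) d (X : measurableType d).

Definition avg (phi : nat -> nat) (n : nat) (S : set X) (x : seqspace X) : R :=
  n%:R^-1 * \sum_(i < n) \1_S (x (phi i)).

Lemma bounded_measurable_coord (S : set X) i : measurable S ->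
  bounded_measurable (fun x : seqspace X => \1_S (x i) : R).
Proof.
move=> mS; split.
  by apply: measurableT_comp => //; exact: measurable_coord.
by exists 1 => x; rewrite indicE; case: (_ \in _); rewrite ?normr0 ?normr1.
Qed.

Lemma bounded_measurable_avg phi n (S : set X) : measurable S ->
  bounded_measurable (avg phi n S).
Proof.
move=> mS; apply: bounded_measurableM; first exact: bounded_measurable_cst.
by apply: bounded_measurable_sum => i; exact: bounded_measurable_coord.
Qed.

Lemma avg_ge0 phi n S x : 0 <= avg phi n S x.
Proof.
by rewrite mulr_ge0 ?invr_ge0 ?ler0n // sumr_ge0.
Qed.

Lemma le_avg phi n S S' x : S `<=` S' -> avg phi n S x <= avg phi n S' x.
Proof.
move=> SS'; rewrite ler_wpM2l ?invr_ge0 ?ler0n // ler_sum // => i _.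
by rewrite !indicE ler_nat; case: (boolP (_ \in S)) => // /set_mem/SS'/mem_set ->.
Qed.

Lemma avgT phi n x : (0 < n)%N -> avg phi n setT x = 1.
Proof.
move=> n0; rewrite /avg; under eq_bigr do rewrite indicE in_setT.
by rewrite sumr_const card_ord mulVf // pnatr_eq0 -lt0n.
Qed.

Lemma avg0 phi n x : avg phi n set0 x = 0.
Proof. by rewrite /avg big1 ?mulr0 // => i _; rewrite indicE in_set0. Qed.

Lemma avg_le1 phi n S x : (0 < n)%N -> avg phi n S x <= 1.
Proof. by move=> n0; rewrite -(avgT phi x n0); exact: le_avg. Qed.

Lemma avgD phi n S S' x : S `<=` S' ->
  avg phi n (S' `\` S) x = avg phi n S' x - avg phi n S x.
Proof.
move=> SS'; rewrite /avg -mulrBr -sumrB; congr (_ * _); apply: eq_bigr => i _.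
rewrite !indicE in_setD.
case: (boolP (x (phi i) \in S)) => [xS|]; last by rewrite andbT subr0.
by rewrite (mem_set (SS' _ (set_mem xS))) subrr.
Qed.

End empirical_averages.
Arguments avg {R d X}.

Section exchangeable_averages.
Context (R : realType) d (X : measurableType d).
Variable P : probability (seqspace X) R.
Hypothesis exP : exchangeable P.

Lemma exchangeable_prod n (phi : nat -> nat) (S : nat -> set X) :
  {in [pred i | (i < n)%N] &, injective phi} ->
  (forall i, (i < n)%N -> measurable (S i)) ->
  \int[P]_x (\prod_(j < n) \1_(S j) (x (phi j))) = fine (P (cylinder n S)).
Proof.
move=> phiI mS.
rewrite -(exchangeable_inj exP phiI mS) /Rintegral; congr fine.
set B := [set x : seqspace X | forall j, (j < n)%N -> S j (x (phi j))].
have mB : measurable B.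
  rewrite (_ : B = \bigcap_(i in [set i | (i < n)%N])
    ((fun x : seqspace X => x (phi i)) @^-1` S i)) //.
  apply: bigcap_measurableType => i /= /mS mSi.
  by rewrite -[X in measurable X]setTI; exact: measurable_coord.
rewrite -[B in RHS]setIT -integral_indic //; apply: eq_integral => x _.
congr EFin; rewrite indicE; have [xB|xB] := boolP (x \in B).
  rewrite big1 // => j _; rewrite indicE mem_set //.
  by have /set_mem/= := xB; apply.
apply/eqP/prodf_eq0; move: xB; rewrite notin_setE /B /=.
move=> /existsNP[j /not_implyP[jn xj]].
exists (Ordinal jn) => //=; rewrite indicE memNset //.
Qed.

Section second_moments.
Variable S : set X.
Hypothesis mS : measurable S.

Let a : R := \int[P]_x \1_S (x 0%N).
Let b : R := \int[P]_x (\1_S (x 0%N) * \1_S (x 1%N)).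

(** By exchangeability the second moment depends only on whether the indices
    coincide; this is all that the mean-square estimate uses. *)
Let pair_moment i j :
  \int[P]_x (\1_S (x i) * \1_S (x j)) = b + (a - b) * (i == j)%:R.
Proof.
pose phi i j k : nat := if k == 0%N then i else j.
have E (k l : nat) : k != l ->
    \int[P]_x (\1_S (x k) * \1_S (x l)) = fine (P (cylinder 2 (fun=> S))).
  move=> kl; rewrite -(exchangeable_prod (phi := phi k l)) //.
    by apply: eq_Rintegral => x _; rewrite 2!big_ord_recl big_ord0 /= mulr1.
  by move=> [|[|?]] [|[|?]] //= _ _; rewrite /phi /= => h; move: kl; rewrite h eqxx.
have E1 (k : nat) : \int[P]_x \1_S (x k) = fine (P (cylinder 1 (fun=> S))).
  rewrite -(exchangeable_prod (phi := fun=> k)) //.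
    by apply: eq_Rintegral => x _; rewrite big_ord_recl big_ord0 /= mulr1.
  by move=> [|?] [|?].
have [<-|ij] := eqVneq i j; last by rewrite mulr0 addr0 /b !E.
rewrite mulr1 addrC subrK /a !E1 -(E1 i); apply: eq_Rintegral => x _.
by rewrite indicE; case: (_ \in _); rewrite ?mulr0 ?mulr1.
Qed.

Let bm i := @bounded_measurable_coord R _ X S i mS.

Let b_ge0 : 0 <= b.
Proof. by apply: Rintegral_ge0 => x _; exact: mulr_ge0. Qed.

Let b_le_a : b <= a.
Proof.
apply: le_Rintegral => //.
- exact/bounded_measurable_integrable/bounded_measurableM.
- exact: bounded_measurable_integrable.
- by move=> x _; rewrite ler_piMr // indicE lern1 leq_b1.
Qed.

Let a_le1 : a <= 1.
Proof.
apply: (@le_trans _ _ (\int[P]_x (cst 1 x))).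
  apply: le_Rintegral => //.
  - exact: bounded_measurable_integrable.
  - exact/bounded_measurable_integrable/bounded_measurable_cst.
  - by move=> x _; rewrite indicE lern1 leq_b1.
by rewrite Rintegral_probability_cst.
Qed.

Let avg_moment phi psi n m : (0 < n)%N -> (0 < m)%N ->
  \int[P]_x (avg phi n S x * avg psi m S x) =
  b + (a - b) * ((n%:R * m%:R)^-1 * \sum_(i < n) \sum_(j < m) (phi i == psi j)%:R).
Proof.
move=> n0 m0.
transitivity (\int[P]_x ((n%:R * m%:R)^-1 * \sum_(i < n) \sum_(j < m)
      (\1_S (x (phi i)) * \1_S (x (psi j))))).
  apply: eq_Rintegral => x _; rewrite /avg mulrACA -invfM; congr (_ * _).
  by rewrite big_distrlr.
rewrite RintegralZl //; last first.
  apply: bounded_measurable_integrable; apply: bounded_measurable_sum => i.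
  by apply: bounded_measurable_sum => j; exact: bounded_measurableM.
rewrite Rintegral_sum; last first.
  by move=> i; apply: bounded_measurable_sum => j; exact: bounded_measurableM.
under eq_bigr => i _.
  rewrite Rintegral_sum; last by move=> j; exact: bounded_measurableM.
  under eq_bigr do rewrite pair_moment.
  rewrite big_split /= sumr_const card_ord -mulr_sumr.
  over.
rewrite big_split /= sumr_const card_ord -mulr_sumr mulrDr; congr (_ + _).
  rewrite -mulrnA -[b *+ _]mulr_natr natrM mulrCA [m%:R * _]mulrC mulVf ?mulr1 //.
  by rewrite mulf_neq0 // pnatr_eq0 -lt0n.
by rewrite mulrCA.
Qed.

Let avg_second_moment phi n : injective phi -> (0 < n)%N ->
  \int[P]_x (avg phi n S x * avg phi n S x) = b + (a - b) / n%:R.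
Proof.
move=> phiI n0; rewrite avg_moment //; congr (_ + _ * _).
under eq_bigr => i _.
  under eq_bigr => j _ do rewrite (inj_eq phiI).
  rewrite (bigD1 i) //= eqxx big1 ?addr0; last first.
    by move=> j ji; rewrite eq_sym (inj_eq val_inj) (negbTE ji).
  over.
by rewrite sumr_const card_ord invfM -mulrA mulVf ?mulr1 // pnatr_eq0 -lt0n.
Qed.

(** Expanding the square, the off-diagonal moment [b] cancels; the diagonal
    contributes [(a - b) / n + (a - b) / m], and indices common to both averages
    only lower the result. *)
Lemma avgB_second_moment phi psi n m : injective phi -> injective psi ->
  (0 < n)%N -> (0 < m)%N ->
  \int[P]_x ((avg phi n S x - avg psi m S x) ^+ 2) <= n%:R^-1 + m%:R^-1.
Proof.
move=> phiI psiI n0 m0.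
have bA p k := @bounded_measurable_avg R _ X p k S mS.
have bAA p k q l := bounded_measurableM (bA p k) (bA q l).
rewrite (@eq_Rintegral _ _ _ P setT (fun x : seqspace X =>
       (avg phi n S x * avg phi n S x + avg psi m S x * avg psi m S x)
       - (avg phi n S x * avg psi m S x + avg phi n S x * avg psi m S x)));
  last by move=> x _; ring.
have I f := @bounded_measurable_integrable _ _ _ P f.
rewrite RintegralB ?RintegralD //; do ?[apply: I];
  do ?[apply: bounded_measurableD]; rewrite ?avg_second_moment ?avg_moment //.
set s := _ * \sum_(_ < n) _.
have s0 : 0 <= s.
  apply: mulr_ge0; first by rewrite invr_ge0 mulr_ge0.
  by do 2?[apply: sumr_ge0 => ? _].
have ab1 : a - b <= 1 by rewrite lerBlDr (le_trans a_le1) // lerDl.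
have an : (a - b) / n%:R <= n%:R^-1 by rewrite ler_piMl ?invr_ge0.
have am : (a - b) / m%:R <= m%:R^-1 by rewrite ler_piMl ?invr_ge0.
have := mulr_ge0 (_ : 0 <= a - b) s0; rewrite subr_ge0 => /(_ b_le_a).
lra.
Qed.

(** A summable bound for the first moment, by the inequality
    [w <= K^-1 + K * w ^+ 2] with [K = 2 ^+ k]. *)
Lemma avgB_first_moment phi psi k l : injective phi -> injective psi ->
  (k <= l)%N ->
  \int[P]_x `|avg phi (4 ^ k) S x - avg psi (4 ^ l) S x| <= 3 / 2 ^+ k.
Proof.
move=> phiI psiI kl.
pose u (x : seqspace X) : R := avg phi (4 ^ k) S x - avg psi (4 ^ l) S x.
rewrite -[leLHS]/(\int[P]_x `|u x|).
have bu : bounded_measurable u.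
  by apply: bounded_measurableB; exact: bounded_measurable_avg.
have bu2 : bounded_measurable (fun x => u x ^+ 2) by exact: bounded_measurableM.
have I f := @bounded_measurable_integrable _ _ _ P f.
have bc := @bounded_measurable_cst _ (seqspace X) R.
have amgm (K w : R) : 0 < K -> 0 <= w -> w <= K^-1 + K * w ^+ 2.
  move=> K0 w0; rewrite -(ler_pM2l K0) mulrDr mulfV ?gt_eqF //.
  have := mulr_ge0 (ltW K0) w0; have := sqr_ge0 (K * w - 1); nra.
apply: (@le_trans _ _ (\int[P]_x ((2 ^+ k)^-1 + 2 ^+ k * u x ^+ 2))).
  apply: le_Rintegral => //.
  - exact/I/bounded_measurable_norm.
  - by apply: I; apply: bounded_measurableD => //; exact: bounded_measurableM.
  - by move=> x _; rewrite -[u x ^+ 2]real_normK ?num_real // amgm.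
rewrite RintegralD //; [|exact/I|exact/I/bounded_measurableM].
rewrite RintegralZl //; last exact: I.
rewrite Rintegral_probability_cst.
have uI : \int[P]_x (u x ^+ 2) <= (4 ^ k)%:R^-1 + (4 ^ l)%:R^-1.
  by apply: avgB_second_moment => //; rewrite expn_gt0.
have lk : (4 ^ l)%:R^-1 <= (4 ^ k)%:R^-1 :> R.
  by rewrite lef_pV2 ?posrE ?ltr0n ?expn_gt0 // ler_nat leq_exp2l.
have {lk} uI2 : \int[P]_x (u x ^+ 2) <= 2 / (4 ^ k)%:R by lra.
have k2 : 2 ^+ k * (2 / (4 ^ k)%:R) = 2 / 2 ^+ k :> R.
  rewrite (_ : 4 = 2 * 2)%N // expnMn natrM !natrX; field.
  by rewrite expf_neq0.
have : 2 ^+ k * \int[P]_x (u x ^+ 2) <= 2 / 2 ^+ k :> R.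
  by rewrite -k2 ler_wpM2l // exprn_ge0.
lra.
Qed.

Lemma ae_avg_cvg :
  {ae P, forall x, cvgn (fun k => avg id (4 ^ k) S x : R)}.
Proof.
have bA k := @bounded_measurable_avg R _ X id k S mS.
have := ae_cvg_series (P := P)
  (u := fun k x => avg id (4 ^ k) S x - avg id (4 ^ k.+1) S x) _
  (fun k => avgB_first_moment (@inj_id _) (@inj_id _) (leqnSn k)).
move=> /(_ (fun k => bounded_measurableB (bA _) (bA _))).
apply: filterS => x cx.
set A := fun k => avg id (4 ^ k) S x : R.
have -> : A = (fun k => A 0%N - series (fun k => A k - A k.+1) k).
  apply/funext => k; rewrite /series /= (telescope_sumr_eq (fun k => - A k)) //.
    by ring.
  by move=> i _; ring.
by apply: is_cvgB => //; exact: is_cvg_cst.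
Qed.

Lemma ae_avgB_cvg0 phi : injective phi ->
  {ae P, forall x, (avg phi (4 ^ k) S x - avg id (4 ^ k) S x : R) @[k --> \oo] --> 0}.
Proof.
move=> phiI.
have bA p k := @bounded_measurable_avg R _ X p k S mS.
have := ae_cvg_series (P := P)
  (u := fun k x => avg phi (4 ^ k) S x - avg id (4 ^ k) S x) _
  (fun k => avgB_first_moment phiI (@inj_id _) (leqnn k)).
move=> /(_ (fun k => bounded_measurableB (bA _ _) (bA _ _))).
by apply: filterS => x; exact: cvg_series_cvg_0.
Qed.

End second_moments.

End exchangeable_averages.

(** * Cylinder probabilities as moments of limiting averages *)

Lemma cvg_bigprod (R : realType) I (s : seq I) (u : I -> nat -> R) (l : I -> R) :
  (forall i, u i k @[k --> \oo] --> l i) ->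
  (\prod_(i <- s) u i k) @[k --> \oo] --> \prod_(i <- s) l i.
Proof.
move=> ul; elim: s => [|i s IHs].
  under eq_fun do rewrite big_nil.
  by rewrite big_nil; exact: cvg_cst.
under eq_fun do rewrite big_cons.
by rewrite big_cons; exact: cvgM.
Qed.

Lemma cvg_EFinE (R : realType) (u : nat -> R) (l : R) :
  u k @[k --> \oo] --> l -> (u k)%:E @[k --> \oo] --> l%:E.
Proof. by move=> ul; apply: cvg_EFin => //; exact: nearW. Qed.

Lemma bounded_convergence (R : realType) d (T : measurableType d)
    (P : probability T R) (W : nat -> T -> R) (U : T -> R) :
  (forall k, measurable_fun setT (W k)) -> (forall k x, `|W k x| <= 1) ->
  measurable_fun setT U -> {ae P, forall x, W k x @[k --> \oo] --> U x} ->
  (\int[P]_x (W k x)%:E)%E @[k --> \oo] --> (\int[P]_x (U x)%:E)%E.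
Proof.
move=> mW W1 mU WU.
have i1 : P.-integrable setT (EFin \o (fun=> 1)).
  by apply: bounded_measurable_integrable; exact: bounded_measurable_cst.
have [||||_ _] := @dominated_convergence _ T R P setT measurableT
  (fun k x => (W k x)%:E) (fun x => (U x)%:E) _ _ _ _ i1 => //.
- by move=> k; apply/measurable_EFinP.
- exact/measurable_EFinP.
- by apply: filterS WU => x h _; exact: cvg_EFinE.
- by apply: aeW => x k _; rewrite lee_fin.
Qed.

Section cylinder_moments.
Context (R : realType) d (X : measurableType d).
Variable P : probability (seqspace X) R.
Hypothesis exP : exchangeable P.

(** The [j]-th factor averages over the residue class of [j] modulo [n]. These
    classes are disjoint, so every monomial of the expanded product has distinct
    coordinates, and all monomials have the same expectation. *)
Lemma exchangeable_block_prod n N (S : nat -> set X) : (0 < N)%N ->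
  (forall i, (i < n)%N -> measurable (S i)) ->
  \int[P]_x (\prod_(j < n) avg (fun i => i * n + j)%N N (S j) x) =
  fine (P (cylinder n S)).
Proof.
move=> N0 mS.
have bI (j : 'I_n) i := @bounded_measurable_coord R _ X (S j) i (mS j (ltn_ord j)).
transitivity (\int[P]_x ((N%:R ^- n) * \sum_(g : {ffun 'I_n -> 'I_N})
    \prod_(j < n) \1_(S j) (x (g j * n + j)%N))).
  apply: eq_Rintegral => x _; rewrite /avg big_split /= prodr_const card_ord.
  by rewrite bigA_distr_bigA exprVn.
rewrite RintegralZl //; last first.
  apply: bounded_measurable_integrable; apply: bounded_measurable_sum => g.
  exact: bounded_measurable_prod.
rewrite Rintegral_sum; last by move=> g; exact: bounded_measurable_prod.
have E (g : {ffun 'I_n -> 'I_N}) :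
    \int[P]_x (\prod_(j < n) \1_(S j) (x (g j * n + j)%N)) = fine (P (cylinder n S)).
  (* The value 0 for arguments outside 'I_n is never read. *)
  pose phi m := (oapp (fun j : 'I_n => val (g j)) 0%N (insub m) * n + m)%N.
  rewrite -(exchangeable_prod exP (phi := phi)) //.
    by apply: eq_Rintegral => x _; apply: eq_bigr => j _; rewrite /phi valK.
  move=> i j; rewrite !inE => ni nj /(congr1 (modn^~ n)).
  by rewrite /phi !modnMDl !modn_small.
under eq_bigr do rewrite E.
rewrite sumr_const card_ffun !card_ord -[X in _ * X]mulr_natr mulrCA natrX.
by rewrite mulVf ?mulr1 // expf_neq0 // pnatr_eq0 -lt0n.
Qed.

(** The block averages have the same limits as the initial averages, while the
    expectation of their product does not depend on the block length. *)
Lemma exchangeable_cylinder n (S : nat -> set X) (U : nat -> seqspace X -> R) :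
  (forall i, (i < n)%N -> measurable (S i)) ->
  (forall i, (i < n)%N -> measurable_fun setT (U i)) ->
  (forall i, (i < n)%N ->
    {ae P, forall x, avg id (4 ^ k) (S i) x @[k --> \oo] --> U i x}) ->
  P (cylinder n S) = (\int[P]_x (\prod_(i < n) U i x)%:E)%E.
Proof.
move=> mS mU SU.
pose W k (x : seqspace X) : R := \prod_(j < n) avg (fun i => i * n + j)%N (4 ^ k) (S j) x.
have bW k : bounded_measurable (W k).
  apply: bounded_measurable_prod => j.
  exact: bounded_measurable_avg (mS j (ltn_ord j)).
have W01 k x : `|W k x| <= 1.
  suff /andP[W0 W1] : 0 <= W k x <= 1 by rewrite ger0_norm.
  apply: (big_ind (fun y : R => 0 <= y <= 1)) => [|y z|j _].
  - by rewrite ler01 lexx.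
  - by move=> /andP[? ?] /andP[? ?]; rewrite mulr_ge0 ?mulr_ile1.
  - by rewrite avg_ge0 avg_le1 // expn_gt0.
have cW : {ae P, forall x, W k x @[k --> \oo] --> \prod_(i < n) U i x}.
  have : {ae P, forall x, forall j, (j < n)%N ->
      (avg (fun i => i * n + j)%N (4 ^ k) (S j) x : R) @[k --> \oo] --> U j x}.
    apply: ae_foralln => j; have [jn|jn] := ltnP j n; last exact: aeW.
    have phiI : injective (fun i => i * n + j)%N.
      move=> a b /addIn /eqP; rewrite eqn_pmul2r ?(leq_ltn_trans _ jn) //.
      by move=> /eqP.
    apply: filterS2 (SU j jn) (ae_avgB_cvg0 exP (mS j jn) phiI) => x Ux Dx _.
    set A := (X in X k @[k --> _]).
    have -> : A = (fun k => (A k - avg id (4 ^ k) (S j) x)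
                            + avg id (4 ^ k) (S j) x).
      by apply/funext => k; rewrite subrK.
    by rewrite -[U j x]add0r; exact: cvgD.
  apply: filterS => x h; apply: cvg_bigprod => j; exact: h.
have mW : measurable_fun setT (fun x => \prod_(i < n) U i x).
  by apply: measurable_prod => j _; exact: mU.
have WE k : (\int[P]_x (W k x)%:E = P (cylinder n S))%E.
  rewrite -[LHS]fineK; last first.
    by apply: integrable_fin_num => //; exact: bounded_measurable_integrable.
  rewrite -[fine _]/(\int[P]_x W k x) exchangeable_block_prod ?expn_gt0 //.
  rewrite fineK // fin_num_measure //; exact: measurable_cylinder.
have := bounded_convergence (fun k => (bW k).1) W01 mW cW.
under eq_fun do rewrite WE.
by move=> /cvg_lim <- //; rewrite lim_cst.
Qed.

End cylinder_moments.

(** * The limiting empirical distribution on the line *)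

Section limiting_frequency.
Context (R : realType) d (X : measurableType d).

Lemma normr_avg_le1 phi k (S : set X) x : `|avg phi (4 ^ k) S x : R| <= 1.
Proof. by rewrite ger0_norm ?avg_ge0 // avg_le1 // expn_gt0. Qed.

Let avg_ub (S : set X) x : has_ubound (range (fun k => avg id (4 ^ k) S x : R)).
Proof.
exists 1 => _ [k _ <-]; exact: le_trans (ler_norm _) (normr_avg_le1 _ _ _ _).
Qed.

Let avg_lb (S : set X) x : has_lbound (range (fun k => avg id (4 ^ k) S x : R)).
Proof. by exists 0 => _ [k _ <-]; exact: avg_ge0. Qed.

(** The upper limit makes the frequency defined for every sequence, measurable
    in the sequence and monotone in the set; monotonicity is what makes
    [cdf_limit] a distribution function without exceptional sequences. *)
Definition freq (S : set X) (x : seqspace X) : R :=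
  limn_sup (fun k => avg id (4 ^ k) S x).

Lemma measurable_freq (S : set X) :
  measurable S -> measurable_fun setT (freq S).
Proof.
move=> mS; apply: measurable_fun_limn_sup => [x _|x _|k].
- exact: avg_ub.
- exact: avg_lb.
- exact: (bounded_measurable_avg _ _ _ mS).1.
Qed.

Lemma le_freq (S S' : set X) x : S `<=` S' -> freq S x <= freq S' x.
Proof.
move=> SS'; apply: ler_lim; do ?[by apply/cvg_ex; eexists; exact: cvg_sups_inf].
apply: nearW => n; apply: sup_le => [_ [k nk <-]||].
- by apply/downP; exists (avg id (4 ^ k) S' x); [exists k|exact: le_avg].
- by exists (avg id (4 ^ n) S x); exists n => /=.
- by split; [exists (avg id (4 ^ n) S' x); exists n => /=|exact: has_ubound_sdrop].
Qed.

Lemma cvg_freq (S : set X) x l :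
  avg id (4 ^ k) S x @[k --> \oo] --> l -> freq S x = l.
Proof. by move=> /cvg_limn_inf_sup[]. Qed.

Lemma freqT x : freq setT x = 1.
Proof.
apply: cvg_freq; under eq_fun do rewrite avgT ?expn_gt0 //; exact: cvg_cst.
Qed.

Lemma freq0 x : freq set0 x = 0.
Proof.
by apply: cvg_freq; under eq_fun do rewrite avg0; exact: cvg_cst.
Qed.

Lemma freq_ge0 S x : 0 <= freq S x.
Proof. by rewrite -(freq0 x) le_freq. Qed.

Lemma freq_le1 S x : freq S x <= 1.
Proof. by rewrite -(freqT x) le_freq. Qed.

Variable P : probability (seqspace X) R.
Hypothesis exP : exchangeable P.

Lemma ae_cvg_freq (S : set X) : measurable S ->
  {ae P, forall x, avg id (4 ^ k) S x @[k --> \oo] --> freq S x}.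
Proof.
move=> mS; apply: filterS (ae_avg_cvg exP mS) => x /cvg_ex[l Sl].
by rewrite (cvg_freq Sl).
Qed.

Lemma integral_freq (S : set X) : measurable S ->
  (\int[P]_x (freq S x)%:E = P (cylinder 1 (fun=> S)))%E.
Proof.
move=> mS; rewrite (exchangeable_cylinder exP (U := fun=> freq S)) //.
- by apply: eq_integral => x _; rewrite big_ord1.
- by move=> *; exact: measurable_freq.
- by move=> *; exact: ae_cvg_freq.
Qed.

End limiting_frequency.
Arguments freq {R d X}.

Section limiting_cdf.
Context (R : realType) d (X : measurableType d).
Variable c : X -> R.
Hypothesis mc : measurable_fun setT c.
Hypothesis c01 : forall y, 0 <= c y <= 1.

Definition below (t : R) : set X := c @^-1` `]-oo, t]%classic.

Lemma measurable_below t : measurable (below t).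
Proof. by rewrite -[X in measurable X]setTI; exact: mc. Qed.

Lemma subset_below s t : s <= t -> below s `<=` below t.
Proof. by move=> st y; rewrite /below /= !in_itv /= => /le_trans; exact. Qed.

Let right (t : R) (n : nat) : R := t + n.+1%:R^-1.

(** Frequencies of half-lines need not be right-continuous in [t], hence the
    limit from the right. *)
Definition cdf_limit (x : seqspace X) (t : R) : R :=
  limn (fun n => freq (below (right t n)) x).

Lemma cvg_cdf_limit x t : freq (below (right t n)) x @[n --> \oo] --> cdf_limit x t.
Proof.
apply: nonincreasing_is_cvgn.
  move=> m n mn; apply/le_freq/subset_below.
  by rewrite lerD2l lef_pV2 ?posrE // ler_nat.
by exists 0 => _ [n _ <-]; exact: freq_ge0.
Qed.

Lemma cdf_limit_le x t n : cdf_limit x t <= freq (below (right t n)) x.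
Proof.
apply: limr_le; first by apply/cvg_ex; eexists; exact: cvg_cdf_limit.
exists n => // m /= nm; apply/le_freq/subset_below.
by rewrite lerD2l lef_pV2 ?posrE // ler_nat.
Qed.

Lemma freq_le_cdf_limit x t : freq (below t) x <= cdf_limit x t.
Proof.
apply: limr_ge; first by apply/cvg_ex; eexists; exact: cvg_cdf_limit.
apply: nearW => n; apply/le_freq/subset_below.
by rewrite lerDl invr_ge0.
Qed.

Lemma cdf_limit_lt0 x t : t < 0 -> cdf_limit x t = 0.
Proof.
move=> t0; apply/eqP; rewrite eq_le (le_trans (freq_ge0 _ _ _) (freq_le_cdf_limit _ _)).
rewrite andbT; have [n tn] : exists n, right t n < 0.
  by have [n] := ltr_add_invr t0; exists n.
apply: le_trans (cdf_limit_le x t n) _; rewrite -(freq0 _ x).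
apply: le_freq => y; rewrite /below /= in_itv /= => yn.
by have /andP[/le_trans/(_ yn)] := c01 y; rewrite leNgt tn.
Qed.

Lemma cdf_limit_ge1 x t : 1 <= t -> cdf_limit x t = 1.
Proof.
move=> t1; apply/eqP; rewrite eq_le (le_trans (cdf_limit_le x t 0) (freq_le1 _ _ _)).
apply: le_trans (freq_le_cdf_limit _ _); rewrite -(freqT _ x).
apply: le_freq => y _; rewrite /below /= in_itv /=.
by have /andP[_ /le_trans] := c01 y; exact.
Qed.

Lemma nondecreasing_cdf_limit x : nondecreasing (cdf_limit x).
Proof.
move=> s t st; apply: ler_lim; do ?[by apply/cvg_ex; eexists; exact: cvg_cdf_limit].
by apply: nearW => n; apply/le_freq/subset_below; rewrite lerD2r.
Qed.

Lemma right_continuous_cdf_limit x : right_continuous (cdf_limit x).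
Proof.
move=> t; apply/cvgrPdist_lt => e e0.
have [n ne] : exists n, freq (below (right t n)) x < cdf_limit x t + e.
  have /cvgrPdist_lt/(_ e e0)[n _ /(_ n (leqnn n))/=] := cvg_cdf_limit (x:=x) (t:=t).
  by rewrite ltr_distlC => /andP[_]; exists n.
near=> s.
have ts : t <= s by apply: ltW; near: s; exact: nbhs_right_gt.
(* The index 2n+1 halves the margin: 1/(n+1) = 1/(2n+2) + 1/(2n+2). *)
have st : s <= right t n.*2.+1.
  by near: s; apply: nbhs_right_le; rewrite ltrDl invr_gt0.
rewrite ler0_norm ?subr_le0 ?nondecreasing_cdf_limit // opprB ltrBlDl.
apply: le_lt_trans ne; apply: le_trans (cdf_limit_le x s n.*2.+1) _.
apply/le_freq/subset_below; rewrite /right.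
have -> : n.+1%:R^-1 = n.*2.+2%:R^-1 + n.*2.+2%:R^-1 :> R.
  rewrite -(doubleS n) -mul2n natrM invfM -mulr2n -[_ *+ 2]mulr_natl mulrA.
  by rewrite mulfV ?mul1r.
by rewrite addrA lerD2r.
Unshelve. all: by end_near. Qed.

Lemma measurable_cdf_limit t : measurable_fun setT (cdf_limit ^~ t).
Proof.
apply: (@measurable_fun_cvg _ _ _ _ (fun n x => freq (below (right t n)) x)).
  by move=> n; apply: measurable_freq; exact: measurable_below.
by move=> x _; exact: cvg_cdf_limit.
Qed.

Lemma cvg_cdf_limitNy x : cdf_limit x @ -oo --> (0 : R).
Proof.
apply: cvg_near_cst; near=> t; apply: cdf_limit_lt0.
by near: t; apply: nbhs_ninfty_lt; exact: real0.
Unshelve. all: by end_near. Qed.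

Lemma cvg_cdf_limity x : cdf_limit x @ +oo --> (1 : R).
Proof.
apply: cvg_near_cst; near=> t; apply: cdf_limit_ge1.
by near: t; apply: nbhs_pinfty_ge; exact: real1.
Unshelve. all: by end_near. Qed.

Definition cdf_cumulative (x : seqspace X) : cumulativeBounded (0 : R) (1 : R) :=
  HB.pack (cdf_limit x)
    (isCumulative.Build R _ R _ (nondecreasing_cdf_limit x) (@right_continuous_cdf_limit x))
    (isCumulativeBounded.Build R 0 1 _ (@cvg_cdf_limitNy x) (@cvg_cdf_limity x)).

Definition limit_law (x : seqspace X) : probability (measurableTypeR R) R :=
  lebesgue_stieltjes_measure (cdf_cumulative x).

Lemma limit_law_itv x a b : a <= b ->
  limit_law x `]a, b]%classic = (cdf_limit x b - cdf_limit x a)%:E.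
Proof.
move=> ab; rewrite /limit_law /=.
rewrite /lebesgue_stieltjes_measure /measure_extension measurable_mu_extE /=; last exact: is_ocitv.
by rewrite wlength_itv_bnd.
Qed.

End limiting_cdf.

(** * Averages converge to the limiting law on every Borel set *)

(** Used to turn a one-sided comparison of limits into an equality: the
    expectations of both sides are probabilities of the same cylinder. *)
Lemma ae_eq_le_integral (R : realType) d (T : measurableType d)
    (P : probability T R) (f g : T -> R) :
  bounded_measurable f -> bounded_measurable g ->
  {ae P, forall x, f x <= g x} ->
  (\int[P]_x (f x)%:E = \int[P]_x (g x)%:E)%E ->
  {ae P, forall x, f x = g x}.
Proof.
move=> bf bg fg ifg.
have If := bounded_measurable_integrable P bf.
have Ig := bounded_measurable_integrable P bg.
have mh : measurable_fun setT (fun x => (g x - f x)%:E).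
  by apply/measurable_EFinP; exact: (bounded_measurableB bg bf).1.
have /ae_eq_integral_abs : (\int[P]_x `|(g x - f x)%:E| = 0)%E.
  transitivity (\int[P]_x (g x - f x)%:E)%E.
    apply: ae_eq_integral => //; first exact: measurableT_comp.
    by apply: filterS fg => x fgx _; rewrite gee0_abs // lee_fin subr_ge0.
  have -> : (\int[P]_x (g x - f x)%:E = \int[P]_x ((g x)%:E - (f x)%:E))%E by [].
  rewrite integralB_EFin // -ifg subee //.
  by rewrite integrable_fin_num.
move=> /(_ measurableT mh); apply: filterS => x /(_ Logic.I) /= [] /eqP.
by rewrite subr_eq0 => /eqP.
Qed.

Section directing_law.
Context (R : realType) d (X : measurableType d).
Variable c : X -> R.
Hypothesis mc : measurable_fun setT c.
Hypothesis c01 : forall y, 0 <= c y <= 1.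

Let law (x : seqspace X) : probability (measurableTypeR R) R := limit_law c01 x.

Lemma measurable_limit_law (B : set (measurableTypeR R)) : measurable B ->
  measurable_fun setT (fun x => law x B).
Proof.
move=> mB.
pose H := [set A : set (measurableTypeR R) |
  measurable A /\ measurable_fun setT (fun x => law x A)].
suff : <<s ocitv (R := R) >> `<=` H by move=> /(_ B mB)[].
apply: lambda_system_subset => //; first exact: ocitvI.
- split => //.
  + split => //=.
    rewrite (_ : (fun x => law x setT) = cst 1%E); first exact: measurable_cst.
    by apply/funext => x; exact: probability_setT.
  + move=> A D DA [mA hA] [mD hD]; split; first exact: measurableD.
    rewrite (_ : (fun x => _) = (fun x => law x A - law x D)%E).
      exact: emeasurable_funB.
    apply/funext => x; rewrite measureD //; last exact: le_lt_trans (probability_le1 _ mA) (ltry _).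
    by rewrite (setIidr DA).
  + move=> F ndF hF; have mF i := (hF i).1.
    have mUF : measurable (\bigcup_i F i) by exact: bigcupT_measurable.
    split => //.
    apply: (@emeasurable_fun_cvg _ _ _ _ (fun n x => law x (F n))).
      by move=> n; exact: (hF n).2.
    by move=> x _; exact: nondecreasing_cvg_mu.
- move=> A oA; split; first exact: sub_sigma_algebra.
  have [->|[[a b] /= ab ->]] := (ocitvP A).1 oA.
    rewrite (_ : (fun x => _) = cst 0%E); first exact: measurable_cst.
    by apply/funext => x; exact: measure0.
  rewrite (_ : (fun x => _) =
      (fun x => (cdf_limit c x b - cdf_limit c x a)%:E)); last first.
    by apply/funext => x; rewrite /law limit_law_itv // ltW.
  by apply/measurable_EFinP; apply: measurable_funB; exact: measurable_cdf_limit.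
Qed.

Variable P : probability (seqspace X) R.
Hypothesis exP : exchangeable P.

Let cyl (S : set X) : set (seqspace X) := cylinder 1 (fun=> S).

Lemma bounded_measurable_freq (S : set X) : measurable S ->
  bounded_measurable (freq S : _ -> R).
Proof.
move=> mS; split; first exact: measurable_freq.
by exists 1 => x; rewrite ger0_norm ?freq_ge0 // freq_le1.
Qed.

(** Passing to the limit from the right costs nothing in expectation, by
    continuity from above of [P]. *)
Lemma integral_cdf_limit t :
  (\int[P]_x (cdf_limit c x t)%:E = P (cyl (below c t)))%E.
Proof.
pose S n := below c (t + n.+1%:R^-1).
have mS n : measurable (S n) by exact: measurable_below.
have : (\int[P]_x (freq (S n) x)%:E)%E @[n --> \oo] -->
       (\int[P]_x (cdf_limit c x t)%:E)%E.
  apply: bounded_convergence.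
  - by move=> n; exact: measurable_freq.
  - by move=> n x; rewrite ger0_norm ?freq_ge0 // freq_le1.
  - exact: measurable_cdf_limit.
  - by apply: aeW => x; exact: cvg_cdf_limit.
under eq_fun do rewrite integral_freq //.
have capS : cyl (below c t) = \bigcap_n cyl (S n).
  apply/seteqP; split => [x tx n _ i i0|x tx i].
    by apply: subset_below (tx i i0); rewrite lerDl invr_ge0.
  case: i => // _; rewrite /below /= in_itv /=.
  apply/ler_addgt0Pr => e e0.
  have [n] := ltr_add_invr e0; rewrite add0r => ne.
  have := tx n Logic.I 0%N isT; rewrite /S /below /= in_itv /= => /le_trans; apply.
  by rewrite lerD2l ltW.
have mcyl S' : measurable S' -> measurable (cyl S').
  by move=> *; exact: measurable_cylinder.
have : P (cyl (S n)) @[n --> \oo] --> P (cyl (below c t)).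
  rewrite capS; apply: nonincreasing_cvg_mu.
  - exact: le_lt_trans (probability_le1 P (mcyl _ (mS 0%N))) (ltry _).
  - by move=> n; exact: mcyl.
  - by rewrite -capS; apply: mcyl; exact: measurable_below.
  - move=> m n mn; apply/subsetPset => x Sx i i0.
    apply: subset_below (Sx i i0).
    by rewrite lerD2l lef_pV2 ?posrE // ler_nat.
move=> /cvg_lim h1 /cvg_lim h2.
by rewrite -h1 // -h2.
Qed.

Lemma ae_cvg_cdf_limit t :
  {ae P, forall x, avg id (4 ^ k) (below c t) x @[k --> \oo] --> cdf_limit c x t}.
Proof.
have mt : measurable (below c t) by exact: measurable_below.
have : {ae P, forall x, freq (below c t) x = cdf_limit c x t}.
  apply: ae_eq_le_integral.
  - exact: bounded_measurable_freq.
  - split; first exact: measurable_cdf_limit.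
    exists 1 => x; rewrite ger0_norm.
      exact: le_trans (cdf_limit_le c x t 0) (freq_le1 _ _ _).
    exact: le_trans (freq_ge0 _ _ _) (freq_le_cdf_limit _ _ _).
  - by apply: aeW => x; exact: freq_le_cdf_limit.
  - by rewrite integral_freq // integral_cdf_limit.
by apply: filterS2 (ae_cvg_freq exP mt) => x + <-.
Qed.

(** Pi-lambda argument from half-open intervals. The averages are only finitely
    additive, so an increasing union yields an inequality between the law and the
    limit of the averages; equality follows by comparing expectations. *)
Lemma ae_cvg_limit_law (B : set (measurableTypeR R)) : measurable B ->
  {ae P, forall x, avg id (4 ^ k) (c @^-1` B) x @[k --> \oo] --> fine (law x B)}.
Proof.
move=> mB.
have mcB A : measurable A -> measurable (c @^-1` A).
  by move=> mA; rewrite -[X in measurable X]setTI; exact: mc.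
have lawfin x A : measurable A -> law x A \is a fin_num.
  by move=> mA; exact: fin_num_measure.
have law01 x A : measurable A -> 0 <= fine (law x A) <= 1.
  move=> mA; rewrite fine_ge0 //= -lee_fin fineK ?lawfin //.
  exact: probability_le1.
have mlaw A : measurable A -> measurable_fun setT (fun x => fine (law x A)).
  by move=> mA; apply: measurableT_comp => //; exact: measurable_limit_law.
have bmlaw A : measurable A -> bounded_measurable (fun x => fine (law x A)).
  move=> mA; split; first exact: mlaw.
  by exists 1 => x; have /andP[? ?] := law01 x _ mA; rewrite ger0_norm.
pose H := [set A : set (measurableTypeR R) | measurable A /\
  {ae P, forall x, avg id (4 ^ k) (c @^-1` A) x @[k --> \oo] --> fine (law x A)}].
suff : <<s ocitv (R := R) >> `<=` H by move=> /(_ B mB)[].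
apply: lambda_system_subset => //; first exact: ocitvI.
- split => //.
  + split => //=; apply: aeW => x; rewrite preimage_setT probability_setT /=.
    under eq_fun do rewrite avgT ?expn_gt0 //.
    exact: cvg_cst.
  + move=> A D DA [mA hA] [mD hD]; split; first exact: measurableD.
    apply: filterS2 hA hD => x hA hD.
    rewrite measureD //; last exact: le_lt_trans (probability_le1 _ mA) (ltry _).
    rewrite (setIidr DA) fineB ?lawfin //.
    rewrite -[c @^-1` _]/(c @^-1` A `\` c @^-1` D).
    have cDA : c @^-1` D `<=` c @^-1` A by move=> y; exact: DA.
    under eq_fun do rewrite avgD //.
    exact: cvgB.
  + move=> F ndF hF; have mF i := (hF i).1.
    have mUF : measurable (\bigcup_i F i) by exact: bigcupT_measurable.
    split => //.
    set UF := \bigcup_i F i in mUF *.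
    have mcUF := mcB _ mUF.
    have lawU x : fine (law x (F n)) @[n --> \oo] --> fine (law x UF).
      apply: fine_cvg; rewrite fineK ?lawfin //; exact: nondecreasing_cvg_mu.
    have : {ae P, forall x, fine (law x UF) = freq (c @^-1` UF) x}.
      apply: ae_eq_le_integral.
      * exact: bmlaw.
      * exact: bounded_measurable_freq.
      * have := ae_foralln (fun n => (hF n).2).
        apply: filterS => x h.
        rewrite -(cvg_lim _ (lawU x)) //.
        apply: limr_le; first by apply/cvg_ex; eexists; exact: lawU.
        apply: nearW => n; rewrite -(cvg_freq (h n)); apply: le_freq.
        by apply: preimage_subset => y Fy; exists n.
      * rewrite integral_freq //.
        have : (\int[P]_x (fine (law x (F n)))%:E)%E @[n --> \oo] -->
               (\int[P]_x (fine (law x UF))%:E)%E.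
          apply: bounded_convergence => [n|n x||].
          - exact: mlaw (mF n).
          - by have /andP[? ?] := law01 x _ (mF n); rewrite ger0_norm.
          - exact: mlaw mUF.
          - by apply: aeW => x; exact: lawU.
        have E n : (\int[P]_x (fine (law x (F n)))%:E = P (cyl (c @^-1` F n)))%E.
          rewrite /cyl (exchangeable_cylinder exP (U := fun=> fun x => fine (law x (F n)))) //.
          - by apply: eq_integral => x _; rewrite big_ord1.
          - by move=> *; exact: mcB (mF n).
          - by move=> *; exact: mlaw (mF n).
          - by move=> *; exact: (hF n).2.
        under eq_fun do rewrite E.
        have : P (cyl (c @^-1` F n)) @[n --> \oo] --> P (cyl (c @^-1` UF)).
          rewrite (_ : cyl (c @^-1` UF) = \bigcup_n cyl (c @^-1` F n)); last first.
            apply/seteqP; split => [x /(_ 0%N isT)[n _ Fn]|x [n _ Fn] i i0].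
              by exists n => // -[].
            by exists n => //; exact: Fn.
          apply: nondecreasing_cvg_mu.
          - by move=> n; apply: measurable_cylinder => *; exact: mcB (mF n).
          - apply: bigcup_measurable => n _.
            by apply: measurable_cylinder => *; exact: mcB (mF n).
          - move=> m n mn; apply/subsetPset => x Fx i i0.
            by have /subsetPset := ndF _ _ mn; apply; exact: Fx.
        by move=> /cvg_lim h1 /cvg_lim h2; rewrite -h1 // -h2.
    by apply: filterS2 (ae_cvg_freq exP mcUF) => x + ->.
- move=> A oA; split; first exact: sub_sigma_algebra.
  have [->|[[a b] /= ab ->]] := (ocitvP A).1 oA.
    apply: aeW => x; rewrite measure0 preimage_set0 /=.
    under eq_fun do rewrite avg0.
    exact: cvg_cst.
  apply: filterS2 (ae_cvg_cdf_limit a) (ae_cvg_cdf_limit b) => x ha hb.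
  rewrite /law limit_law_itv ?ltW //=.
  rewrite (_ : c @^-1` _ = below c b `\` below c a); last first.
    apply/seteqP; split => y; rewrite /below /= !in_itv /=.
      by move=> /andP[ay ->]; split => //; apply/negP; rewrite -ltNge.
    by move=> [-> /negP]; rewrite -ltNge => ->.
  have cab : below c a `<=` below c b by apply: subset_below; exact: ltW.
  under eq_fun do rewrite avgD //.
  exact: (cvgB hb ha).
Qed.

End directing_law.

(** * The directing random measure and the kernel *)

Section probability_space_measurability.
Context (R : realType) d (X : measurableType d).

Lemma measurable_evaluation (S : set X) : measurable S ->
  measurable_fun setT (fun q : probspace X R => fine ((q : probability X R) S)).
Proof.
move=> mS _ B mB; rewrite setTI; apply: sub_sigma_algebra.
exists (\1_S : X -> R); split.
- exact: measurable_indic.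
- by exists 1 => y; rewrite indicE; case: (_ \in _); rewrite ?normr0 ?normr1.
exists B => //; apply/seteqP; split => q /=;
  by rewrite /preimage /= /Rintegral integral_indic // setIT.
Qed.

(** The sigma-algebra of [probspace] is generated by integrals of bounded
    functions; these are measurable as differences of two integrals against a
    kernel. *)
Lemma measurable_into_probspace d' (T : measurableType d') (psi : T -> probability X R) :
  (forall S, measurable S -> measurable_fun setT (fun x => psi x S)) ->
  measurable_fun setT (psi : T -> probspace X R).
Proof.
move=> mpsi.
have mE : @measurable _ (probspace X R) = <<s @integral_preimages _ X R >> by [].
apply: (measurability _ mE).
move=> _ [_ [f [mf _ [B mB ->]]] <-].
have mpos : measurable_fun setT (fun x => \int[psi x]_y ((EFin \o f)^\+ y))%E.
  apply: measurable_fun_integral_kernel => //.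
  by apply: measurable_funepos; apply/measurable_EFinP.
have mneg : measurable_fun setT (fun x => \int[psi x]_y ((EFin \o f)^\- y))%E.
  apply: measurable_fun_integral_kernel => //.
  by apply: measurable_funeneg; apply/measurable_EFinP.
have mI : measurable_fun setT (fun x => \int[psi x]_y f y).
  apply: measurableT_comp => //.
  under eq_fun do rewrite integralE.
  exact: emeasurable_funB.
exact: mI.
Qed.

End probability_space_measurability.

Lemma prode_fin (R : realType) n (f : 'I_n -> \bar R) :
  (forall i, f i \is a fin_num) ->
  (\prod_(i < n) f i)%E = (\prod_(i < n) fine (f i))%:E.
Proof.
by move=> ff; rewrite -prodEFin; apply: eq_bigr => i _; rewrite fineK.
Qed.

Lemma measurable_prod_evaluation (R : realType) d (X : measurableType d) n
    (S : nat -> set X) : (forall i, (i < n)%N -> measurable (S i)) ->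
  measurable_fun setT
    (fun q : probspace X R => \prod_(i < n) (q : probability X R) (S i))%E.
Proof.
move=> mS; rewrite (_ : (fun q => _) = (fun q : probspace X R =>
    (\prod_(i < n) fine ((q : probability X R) (S i)))%:E)).
  apply/measurable_EFinP; apply: measurable_prod => i _.
  exact: measurable_evaluation (mS i (ltn_ord i)).
apply/funext => q; rewrite prode_fin // => i.
by rewrite fin_num_measure //; exact: mS.
Qed.

Section directing_measure.
Context (R : realType) d (X : measurableType d).
Variables (c : X -> R) (g : R -> X).
Hypothesis mc : measurable_fun setT c.
Hypothesis mg : measurable_fun setT (g : measurableTypeR R -> X).
Hypothesis c01 : forall y, 0 <= c y <= 1.
Hypothesis cK : cancel c g.

Let decode : {mfun measurableTypeR R >-> X} :=
  HB.pack (g : measurableTypeR R -> X) (isMeasurableFun.Build _ _ _ _ _ mg).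

Definition directing_measure (x : seqspace X) : probability X R :=
  distribution (limit_law c01 x) decode.

Lemma measurable_directing_measure :
  measurable_fun setT (directing_measure : seqspace X -> probspace X R).
Proof.
apply: measurable_into_probspace => S mS.
apply: measurable_limit_law => //.
by rewrite -[X in measurable X]setTI; exact: mg.
Qed.

Variable P : probability (seqspace X) R.
Hypothesis exP : exchangeable P.

(** Since [g] inverts [c], the preimage under [c] of [g @^-1` S] is [S] itself,
    so the averages over [S] converge to the directing measure of [S]. *)
Lemma cylinder_directing_measure n (S : nat -> set X) :
  (forall i, (i < n)%N -> measurable (S i)) ->
  P (cylinder n S) = (\int[P]_x \prod_(i < n) directing_measure x (S i))%E.
Proof.
move=> mS.
have mgS i : (i < n)%N -> measurable (g @^-1` S i : set (measurableTypeR R)).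
  by move=> /mS mSi; rewrite -[X in measurable X]setTI; exact: mg.
rewrite (exchangeable_cylinder exP
  (U := fun i x => fine (directing_measure x (S i)))) //.
- apply: eq_integral => x _; rewrite prode_fin // => i.
  by rewrite fin_num_measure //; exact: mS.
- move=> i ni; apply: measurableT_comp => //.
  apply: measurable_limit_law => //; exact: mgS.
- move=> i ni; have := ae_cvg_limit_law mc c01 exP (mgS i ni).
  rewrite (_ : c @^-1` _ = S i) //.
  by apply/seteqP; split => y; rewrite /preimage /= cK.
Qed.

End directing_measure.

Section pushforward_kernel.
Context (R : realType) dA dT dU (A : measurableType dA) (T : measurableType dT)
  (U : measurableType dU).
Variables (p : R.-pker A ~> T) (f : {mfun T >-> U}).

Definition kernel_probability (a : A) : set T -> \bar R := p a.

HB.instance Definition _ a := Measure.on (kernel_probability a).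

Let kernel_probability_setT a : kernel_probability a setT = 1%E.
Proof. exact: prob_kernel. Qed.

HB.instance Definition _ a := Measure_isProbability.Build _ _ _
  (kernel_probability a) (kernel_probability_setT a).

Definition pushforward_kernel (a : A) : {measure set U -> \bar R} :=
  distribution (kernel_probability a) f.

Let measurable_pushforward_kernel V : measurable V ->
  measurable_fun setT (pushforward_kernel ^~ V).
Proof.
move=> mV; apply: (measurable_kernel p).
by rewrite -[X in measurable X]setTI; exact: measurable_funPT.
Qed.

HB.instance Definition _ := isKernel.Build _ _ _ _ _ pushforward_kernel
  measurable_pushforward_kernel.

Let pushforward_kernel_setT a : pushforward_kernel a setT = 1%E.
Proof. exact: probability_setT. Qed.

HB.instance Definition _ := Kernel_isProbability.Build _ _ _ _ _
  pushforward_kernel pushforward_kernel_setT.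

End pushforward_kernel.

Theorem mainTheorem2 (R : realType) (dA dX : measure_display)
    (A : measurableType dA) (X : measurableType dX)
    (hA : standard_borel R A) (hX : standard_borel R X)
    (p : R.-pker A ~> seqspace X) :
  (forall a : A, exchangeable (p a)) <->
  exists mu : R.-pker A ~> probspace X R,
    forall (a : A) (n : nat) (S : nat -> set X),
      (forall i, (i < n)%N -> measurable (S i)) ->
      p a (cylinder n S) =
      (\int[mu a]_q \prod_(i < n) (q : probability X R) (S i))%E.
Proof.
split => [exP|[mu hmu] a s m [bs _] [_ sfix] S mS].
  have [c [g [mc mg c01 cK]]] := standard_borel_retract hX.
  pose psi := directing_measure mg c01.
  pose psi_mixin := isMeasurableFun.Build _ _ _ _ _
    (measurable_directing_measure mc mg c01).
  pose Psi : {mfun seqspace X >-> probspace X R} :=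
    HB.pack (psi : seqspace X -> probspace X R) psi_mixin.
  exists (pushforward_kernel p Psi) => a n S mS.
  rewrite [RHS]ge0_integral_distribution.
  - exact: (cylinder_directing_measure mc mg c01 cK
      (P := kernel_probability p a) (exP a)).
  - exact: measurable_prod_evaluation.
  - by move=> q; apply: prode_ge0.
have sI := bij_inj bs.
have sm i : (i < m.+1)%N -> (s i < m.+1)%N.
  rewrite !ltnS => im; rewrite leqNgt; apply/negP => si.
  by have /sI sii := sfix _ si; move: si; rewrite sii ltnNge im.
rewrite !hmu //; last by move=> i im; apply: mS; exact: sm.
apply: eq_integral => q _.
pose t (i : 'I_m.+1) : 'I_m.+1 := Ordinal (sm i (ltn_ord i)).
have tI : injective t by move=> i j /(congr1 val) /= /sI /val_inj.
by rewrite (reindex_inj tI).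
Qed.
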